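(* Let $n\ge 2$ be an integer, $0<\alpha<1$, and let $\mathcal{K}$ be the $n\times n$ first-order stable spline kernel, $\mathcal{K}_{ij}=\alpha^{\max(i,j)}$ for $1\le i,j\le n$. The following are equivalent. (i) $\mathcal{K}$ solves the maximum entropy band extension problem $$\text{minimize } -\log\det\Sigma\quad\text{over symmetric }\Sigma\in\mathbb{R}^{n\times n}\quad\text{subject to }\ \Sigma\succeq 0,\qquad \Sigma_{ij}=\alpha^{\max(i,j)}\ \text{ for all }(i,j)\text{ with }|i-j|\le 1 .$$ (ii) $\mathcal{K}$ admits the factorization $\mathcal{K}=UWU^\top$, where $U\in\mathbb{R}^{n\times n}$ is the upper triangular matrix with $U_{ij}=1$ for $i\le j$ and $U_{ij}=0$ for $i>j$, and $$W=(\alpha-\alpha^2)\,\operatorname{diag}\left\{1,\alpha,\alpha^2,\dots,\alpha^{n-2},\frac{\alpha^{n-1}}{1-\alpha}\right\}.$$ (iii) $\mathcal{K}^{-1}$ is tridiagonal and is given by $\mathcal{K}^{-1}=\frac{1}{\alpha-\alpha^2}\,T$, where $T\in\mathbb{R}^{n\times n}$ is the symmetric tridiagonal matrix with entries $$T_{11}=1,\qquad T_{ii}=\frac{1}{\alpha^{i-2}}+\frac{1}{\alpha^{i-1}}\ \ (2\le i\le n-1),\qquad T_{nn}=\frac{1}{\alpha^{n-2}}+\frac{1-\alpha}{\alpha^{n-1}},$$ $$T_{i,i+1}=T_{i+1,i}=-\frac{1}{\alpha^{i-1}}\ \ (1\le i\le n-1),\qquad T_{ij}=0\ \ (|i-j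|>1).$$
   Context: $\Sigma\succeq 0$ means that $\Sigma$ is positive semidefinite, and by convention $-\log\det\Sigma=+\infty$ when $\Sigma$ is singular. $\operatorname{diag}\{a_1,\dots,a_n\}$ denotes the diagonal matrix with diagonal entries $a_1,\dots,a_n$. *)

(* Defs.v *)
From HB Require Import structures.
From mathcomp Require Import all_boot all_order all_algebra.
From mathcomp Require Import all_classical all_reals all_analysis.
Set Implicit Arguments.
Unset Strict Implicit.
Unset Printing Implicit Defensive.
Import Order.TTheory GRing.Theory Num.Theory.
Local Open Scope ring_scope.

(* 'I_n is 0-based: the mathematical 1-based indices are i.+1 and j.+1. *)

Definition ss_kernel (R : realType) (n : nat) (alpha : R) : 'M[R]_n :=
  \matrix_(i < n, j < n) alpha ^+ maxn i.+1 j.+1.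

Definition psdmx (R : realType) (n : nat) (S : 'M[R]_n) : Prop :=
  forall x : 'cV[R]_n, 0 <= (x^T *m S *m x) 0 0.

(* Only meaningful on positive semidefinite matrices, where the determinant
   is nonnegative and vanishes exactly in the singular case. *)
Definition neg_logdet (R : realType) (n : nat) (S : 'M[R]_n) : \bar R :=
  if S \in unitmx then (- ln (\det S))%:E else +oo%E.

Definition band_feasible (R : realType) (n : nat) (alpha : R)
    (S : 'M[R]_n) : Prop :=
  [/\ S^T = S, psdmx S &
      forall i j : 'I_n, (`|i - j| <= 1)%N ->
        S i j = alpha ^+ maxn i.+1 j.+1].

Definition solves_min (R : realType) (T : Type) (feasible : T -> Prop)
    (objective : T -> \bar R) (x : T) : Prop :=
  feasible x /\ forall y, feasible y -> (objective x <= objective y)%E.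

Definition solves_maxent_band (R : realType) (n : nat) (alpha : R)
    (S : 'M[R]_n) : Prop :=
  solves_min (@band_feasible R n alpha) (@neg_logdet R n) S.

Definition umat (R : realType) (n : nat) : 'M[R]_n :=
  \matrix_(i < n, j < n) (if (i <= j)%N then 1 else 0).

Definition wmat (R : realType) (n : nat) (alpha : R) : 'M[R]_n :=
  (alpha - alpha ^+ 2) *:
    diag_mx (\row_(i < n) (if i.+1 == n then alpha ^+ (n - 1) / (1 - alpha)
                           else alpha ^+ i)).

Definition tridiagonal (R : realType) (n : nat) (A : 'M[R]_n) : Prop :=
  forall i j : 'I_n, (1 < `|i - j|)%N -> A i j = 0.

(* Entry in 1-based row p and column q; the branches do not overlap when
   2 <= n, and the truncated subtractions are then exact. *)
Definition tentry (R : realType) (n : nat) (alpha : R) (p q : nat) : R :=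
  if p == q then
    if p == 1%N then 1
    else if p == n then
      1 / alpha ^+ (n - 2) + (1 - alpha) / alpha ^+ (n - 1)
    else 1 / alpha ^+ (p - 2) + 1 / alpha ^+ (p - 1)
  else if q == p.+1 then - (1 / alpha ^+ (p - 1))
  else if p == q.+1 then - (1 / alpha ^+ (q - 1))
  else 0.

Definition tmat (R : realType) (n : nat) (alpha : R) : 'M[R]_n :=
  \matrix_(i < n, j < n) tentry n alpha i.+1 j.+1.

(* Main.v *)
(* Each of (i), (ii), (iii) holds, so the equivalences follow.
   Let V be the inverse of U, the first-order difference matrix.  Every row of V
   is supported on two consecutive indices, so the diagonal of V S V^T only
   involves the band entries of S: it is the diagonal of W for every feasible S.
   Hadamard's inequality then gives
   det S = det (V S V^T) <= det W = det (U W U^T),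
   so that U W U^T, which telescopes to K, maximizes the determinant.
   Its inverse is V^T W^-1 V. *)
Require Import Defs.
From HB Require Import structures.
From mathcomp Require Import all_boot all_order all_algebra.
From mathcomp Require Import all_classical all_reals all_analysis.
From mathcomp Require Import zify ring lra.
Set Implicit Arguments.
Unset Strict Implicit.
Unset Printing Implicit Defensive.
Import Order.TTheory GRing.Theory Num.Theory.
Local Open Scope ring_scope.

(** * Positive semidefinite matrices and Hadamard's inequality *)

Lemma psdmx_congr (R : realType) (m n : nat) (A : 'M[R]_(m, n)) (S : 'M[R]_n) :
  psdmx S -> psdmx (A *m S *m A^T).
Proof.
move=> psdS x; have := psdS (A^T *m x).
by rewrite trmx_mul trmxK !mulmxA.
Qed.

Lemma psdmx_diag_ge0 (R : realType) (n : nat) (S : 'M[R]_n) (i : 'I_n) :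
  psdmx S -> 0 <= S i i.
Proof.
move=> psdS; have := psdS (delta_mx i 0).
by rewrite trmx_delta -rowE -colE !mxE.
Qed.

Lemma psdmx_diag_mx (R : realType) (n : nat) (d : 'rV[R]_n) :
  (forall i, 0 <= d 0 i) -> psdmx (diag_mx d).
Proof.
move=> d_ge0 x; rewrite mul_mx_diag mxE sumr_ge0 // => k _.
by rewrite !mxE mulrAC -expr2 mulr_ge0 ?sqr_ge0.
Qed.

(** With a zero corner the quadratic form is affine in the first coordinate, and an affine function
    bounded below on the whole line has slope zero. *)
Lemma psdmx_ulsub0 (R : realType) (n : nat) (b : 'cV[R]_n) (C : 'M[R]_n) :
  psdmx (block_mx (0 : 'M[R]_1) b^T b C) -> b = 0.
Proof.
move=> psdM; apply/matrixP => i j; rewrite ord1 [RHS]mxE {j}.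
have quad t : 0 <= t * b i 0 *+ 2 + C i i.
  have := psdM (col_mx (t%:M : 'M[R]_1) (delta_mx i 0)).
  rewrite tr_col_mx mul_row_block mul_row_col tr_scalar_mx mulmx0 add0r.
  rewrite trmx_delta mulmxDl !mul_scalar_mx -!rowE -colE mul_mx_scalar.
  by rewrite -colE !mxE addrA -mulr2n.
have [// | b_neq0] := eqVneq (b i 0) 0.
(* This value of [t] makes the form equal to -1. *)
have := quad (- (C i i + 1) / b i 0 / 2); rewrite mulrAC divfK //.
by move=> h; exfalso; lra.
Qed.

(** Induction on the size through the Schur complement of the corner [a], which is again positive
    semidefinite and whose diagonal is dominated by that of [C]. *)
Lemma hadamard_psdmx (R : realType) (n : nat) (M : 'M[R]_n) :
  M^T = M -> psdmx M -> 0 <= \det M <= \prod_i M i i.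
Proof.
elim: n M => [|n IHn] M symM psdM.
  by rewrite det_mx00 big_ord0 ler01 lexx.
move: M symM psdM; rewrite -[n.+1]/(1 + n)%N => M symM psdM.
have diag_ge0 i : 0 <= M i i by exact: psdmx_diag_ge0.
set b := dlsubmx M; set C := drsubmx M; set a := M 0 0.
have eqM : M = block_mx a%:M b^T b C.
  rewrite -[LHS]submxK; congr block_mx.
    by rewrite [LHS]mx11_scalar !mxE !lshift0.
  by rewrite /b trmx_dlsub symM.
have symC : C^T = C by rewrite /C trmx_drsub symM.
have diagC i : M (rshift 1 i) (rshift 1 i) = C i i by rewrite !mxE.
(* A zero pivot cannot be eliminated with, but it forces [b = 0], hence a zero determinant. *)
have [a0 | a_neq0] := eqVneq a 0.
  move: psdM; rewrite {1}eqM a0 raddf0 => /psdmx_ulsub0 b0.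
  by rewrite {1 2}eqM b0 trmx0 det_ublock a0 raddf0 det_mx11 mxE mul0r lexx prodr_ge0.
have a_gt0 : 0 < a by rewrite lt_def a_neq0 diag_ge0.
(* [L] performs one step of Gaussian elimination; [S] is the resulting Schur complement. *)
pose L : 'M[R]_(1 + n) := block_mx 1%:M 0 (- a^-1 *: b) 1%:M.
pose S := C - a^-1 *: (b *m b^T).
have LM : L *m M = block_mx a%:M b^T 0 S.
  rewrite eqM /L mulmx_block !mul1mx !mul0mx !addr0; congr block_mx.
    by rewrite mul_mx_scalar scalerA mulrN mulfV // scaleN1r addNr.
  by rewrite -scalemxAl scaleNr addrC.
have detM : \det M = a * \det S.
  have := congr1 determinant LM.
  by rewrite det_mulmx det_lblock !det1 !mul1r det_ublock det_scalar expr1.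
(* Eliminating the first row as well gives a congruence, through which [S] inherits positivity from
   [M]. *)
have LML : L *m M *m L^T = block_mx a%:M 0 0 S.
  rewrite LM /L tr_block_mx !trmx1 trmx0 mulmx_block !mulmx1 !mulmx0 !mul0mx.
  rewrite !add0r !addr0; congr block_mx.
  by rewrite linearZ /= mul_scalar_mx scalerA mulrN mulfV // scaleN1r addNr.
have psdS : psdmx S.
  move=> y; have := psdmx_congr L psdM (col_mx 0 y).
  by rewrite LML tr_col_mx mul_row_block mul_row_col trmx0 !mul0mx !mulmx0 !add0r.
have symS : S^T = S by rewrite /S linearB linearZ /= trmx_mul trmxK symC.
have /andP[detS_ge0 detS_le] := IHn S symS psdS.
rewrite detM mulr_ge0 ?diag_ge0 //= big_split_ord /= big_ord1 lshift0.
rewrite ler_wpM2l ?diag_ge0 //.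
apply: le_trans detS_le _; apply: ler_prod => i _; rewrite psdmx_diag_ge0 //=.
(* The two diagonals differ by the square of an entry of [b] divided by [a]. *)
rewrite diagC /S !mxE big_ord1 !mxE lerBlDr lerDl.
by rewrite mulr_ge0 ?invr_ge0 ?(ltW a_gt0) // -expr2 sqr_ge0.
Qed.

(** * The first-order difference matrix *)

Definition diffmx (R : realType) (n : nat) : 'M[R]_n :=
  \matrix_(i < n, j < n) ((i == j :> nat)%:R - (i.+1 == j)%:R).

(** The index [p] is a natural number so that it may run past the end, as [i.+1] does in the last
    row of [diffmx]; the sum is then empty of nonzero terms. *)
Lemma sum_eqnatl (R : realType) (n p : nat) (F : nat -> R) :
  \sum_(k < n) (p == k)%:R * F k = if (p < n)%N then F p else 0.
Proof.
case: ifP => [ltpn | /negbT]; last first.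
  rewrite -leqNgt => lenp; rewrite big1 // => k _.
  by rewrite gtn_eqF ?mul0r // (leq_trans (ltn_ord k)).
rewrite (bigD1 (Ordinal ltpn)) //= eqxx mul1r big1 ?addr0 // => k kp.
by rewrite [p == k]eq_sym -[p]/(val (Ordinal ltpn)) (inj_eq val_inj) (negbTE kp) mul0r.
Qed.

Lemma mul_diffmx_umat (R : realType) (n : nat) : diffmx R n *m umat R n = 1%:M.
Proof.
apply/matrixP => i j; rewrite !mxE.
under eq_bigr do rewrite !mxE mulrBl.
rewrite sumrB !(sum_eqnatl n _ (fun k => if (k <= j)%N then 1 else 0)) ltn_ord.
have -> : (i == j) = (i == j :> nat) by [].
have jn := ltn_ord j.
by case: (ltngtP i j) => ij; case: ifP => i1n; rewrite ?subrr ?subr0 //; lia.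
Qed.

Lemma det_umat (R : realType) (n : nat) : \det (umat R n) = 1.
Proof.
rewrite -det_tr det_trig; first by rewrite big1 // => i _; rewrite !mxE leqnn.
by apply/is_trig_mxP => i j ltij; rewrite !mxE leqNgt ltij.
Qed.

Lemma diffmx_congr_diag (R : realType) (n : nat) (A B : 'M[R]_n) (i : 'I_n) :
  (forall k l : 'I_n, (`|k - l| <= 1)%N -> A k l = B k l) ->
  (diffmx R n *m A *m (diffmx R n)^T) i i =
  (diffmx R n *m B *m (diffmx R n)^T) i i.
Proof.
move=> eqAB; rewrite !mxE; apply: eq_bigr => l _.
rewrite !mxE !mulr_suml; apply: eq_bigr => k _; rewrite !mxE.
have [/eqAB -> // | far] := leqP `|k - l|%N 1.
(* Two indices more than one apart cannot both lie in the support [{i, i.+1}] of row [i], so one of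
   the two factors vanishes. *)
have [ik |] := boolP ((i == k :> nat) || (i.+1 == k)); last first.
  by rewrite negb_or => /andP[/negbTE-> /negbTE->]; rewrite subrr !mul0r.
have [-> ->] : (i == l :> nat) = false /\ (i.+1 == l) = false by lia.
by rewrite subrr !mulr0.
Qed.

(** * Factorization and optimality of the stable spline kernel *)

Section StableSpline.
Variables (R : realType) (alpha : R).
Hypotheses (alpha_gt0 : 0 < alpha) (alpha_lt1 : alpha < 1).

(** The diagonal of [wmat], indexed by natural numbers so that it can be summed over intervals. *)
Let wt (n k : nat) : R := (alpha - alpha ^+ 2) *
  (if k.+1 == n then alpha ^+ (n - 1) / (1 - alpha) else alpha ^+ k).

Let scale_gt0 : 0 < alpha - alpha ^+ 2.
Proof. by rewrite subr_gt0 expr2 gtr_pMr. Qed.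

Let wmatE n : wmat n alpha = diag_mx (\row_(i < n) wt n i).
Proof. by apply/matrixP => i j; rewrite !mxE mulrnAr. Qed.

Let wt_gt0 n k : 0 < wt n k.
Proof.
rewrite mulr_gt0 //; case: ifP => _; rewrite ?exprn_gt0 //.
by rewrite divr_gt0 ?exprn_gt0 ?subr_gt0.
Qed.

(** Every weight but the last is a difference of consecutive powers of [alpha], and the last one,
    [alpha ^+ n], is exactly what the telescoped sum leaves over. *)
Lemma sum_wt n p : (p < n)%N -> \sum_(p <= k < n) wt n k = alpha ^+ p.+1.
Proof.
case: n => // n; rewrite ltnS => lepn; rewrite big_nat_recr //=.
have -> : \sum_(p <= k < n) wt n.+1 k =
    \sum_(p <= k < n) - (alpha ^+ k.+2 - alpha ^+ k.+1).
  apply: eq_big_nat => k /andP[_ ltkn].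
  by rewrite /wt eqSS ltn_eqF // !exprS; ring.
rewrite sumrN (telescope_sumr (fun k => alpha ^+ k.+1)) // /wt eqxx subn1 /= !exprS.
have : 1 - alpha != 0 by rewrite subr_eq0 gt_eqF.
by move=> h; field.
Qed.

Lemma ss_kernel_factor n :
  ss_kernel n alpha = umat R n *m wmat n alpha *m (umat R n)^T.
Proof.
apply/matrixP => i j; rewrite wmatE mul_mx_diag !mxE.
have -> : maxn i.+1 j.+1 = (maxn i j).+1 by rewrite maxnSS.
(* Entry (i, j) of the product sums the weights over the [k] that are at least both [i] and [j]. *)
rewrite -(@sum_wt n) ?gtn_max ?ltn_ord // big_nat_cond.
rewrite (big_nat_widenl _ 0) //= big_mkord big_mkcond /=.
apply: eq_bigr => k _; rewrite !mxE ltn_ord andbT geq_max.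
by do 2 case: leqP => _; rewrite ?mul1r ?mulr1 ?mul0r ?mulr0.
Qed.

Lemma det_ss_kernel n : \det (ss_kernel n alpha) = \prod_(i < n) wt n i.
Proof.
rewrite ss_kernel_factor !det_mulmx det_tr det_umat mul1r mulr1 wmatE det_diag.
by apply: eq_bigr => i _; rewrite mxE.
Qed.

Lemma ss_kernel_unitmx n : ss_kernel n alpha \in unitmx.
Proof. by rewrite unitmxE unitfE det_ss_kernel gt_eqF // prodr_gt0. Qed.

Lemma band_feasible_ss_kernel n : band_feasible alpha (ss_kernel n alpha).
Proof.
split; first by apply/matrixP => i j; rewrite !mxE maxnC.
  rewrite ss_kernel_factor wmatE; apply: psdmx_congr.
  by apply: psdmx_diag_mx => i; rewrite mxE ltW.
by move=> i j _; rewrite mxE.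
Qed.

Lemma det_band_feasible n (S : 'M[R]_n) : band_feasible alpha S ->
  0 <= \det S <= \det (ss_kernel n alpha).
Proof.
case=> symS psdS bandS; pose V := diffmx R n.
have VU : V *m umat R n = 1%:M by exact: mul_diffmx_umat.
have detV : \det V = 1.
  by have := congr1 determinant VU; rewrite det_mulmx det_umat mulr1 det1.
have symM : (V *m S *m V^T)^T = V *m S *m V^T.
  by rewrite !trmx_mul trmxK symS mulmxA.
have := hadamard_psdmx symM (psdmx_congr V psdS).
rewrite !det_mulmx det_tr detV mul1r mulr1 det_ss_kernel.
suff -> : \prod_i (V *m S *m V^T) i i = \prod_(i < n) wt n i by [].
apply: eq_bigr => i _.
(* [S] and the kernel agree on the band, so the kernel may replace [S] here; its congruence by [V]
   is [wmat] itself. *)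
rewrite (@diffmx_congr_diag _ _ _ (ss_kernel n alpha)); last first.
  by move=> k l /bandS ->; rewrite mxE.
rewrite ss_kernel_factor !mulmxA VU mul1mx -mulmxA -trmx_mul VU trmx1 mulmx1.
by rewrite wmatE !mxE eqxx.
Qed.

Lemma ss_kernel_maxent n : solves_maxent_band alpha (ss_kernel n alpha).
Proof.
split=> [|S feasS]; first exact: band_feasible_ss_kernel.
rewrite /neg_logdet ss_kernel_unitmx; case: ifP => [unitS | _]; last exact: leey.
have /andP[detS_ge0 detS_le] := det_band_feasible feasS.
have detS_gt0 : 0 < \det S by rewrite lt_def -unitfE -unitmxE unitS.
by rewrite lee_fin lerN2 ler_ln ?posrE // (lt_le_trans detS_gt0).
Qed.

(** * The tridiagonal inverse *)

Lemma tmat_factor n : (2 <= n)%N ->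
  (1 / (alpha - alpha ^+ 2)) *: tmat n alpha =
  (diffmx R n)^T *m diag_mx (\row_(i < n) (wt n i)^-1) *m diffmx R n.
Proof.
move=> n_ge2; apply/matrixP => i j; rewrite mul_mx_diag !mxE.
(* [G] is column [j] of the product of the inverse weights with [diffmx]. Column [i] of [diffmx] is
   supported on rows [i - 1] and [i], so the entry is [G i - G (i - 1)], without the second term
   when [i = 0]. *)
pose G k : R := (wt n k)^-1 * ((k == j :> nat)%:R - (k.+1 == j)%:R).
transitivity (\sum_(k < n) ((i == k :> nat)%:R * G k - (k.+1 == i)%:R * G k)); last first.
  by apply: eq_bigr => k _; rewrite !mxE /G -mulrBl mulrA (eq_sym (i : nat) k).
rewrite sumrB sum_eqnatl ltn_ord.
have -> : \sum_(k < n) (k.+1 == i)%:R * G k = if (i : nat) is p.+1 then G p else 0.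
  have := ltn_ord i; case: (i : nat) => [_ | p ltpn].
    by rewrite big1 // => k _; rewrite mul0r.
  transitivity (\sum_(k < n) (p == k)%:R * G k).
    by apply: eq_bigr => k _; rewrite eqSS eq_sym.
  by rewrite sum_eqnatl ltnW.
have wt_lt k : (k.+1 < n)%N -> (wt n k)^-1 = 1 / (alpha - alpha ^+ 2) * (1 / alpha ^+ k).
  by move=> /ltn_eqF kn; rewrite /wt kn invfM !div1r.
have wt_max k : k.+1 = n ->
    (wt n k)^-1 = 1 / (alpha - alpha ^+ 2) * ((1 - alpha) / alpha ^+ k).
  by move=> <-; rewrite /wt eqxx subn1 invfM invf_div !div1r.
rewrite /G /tentry; have := ltn_ord j; have := ltn_ord i.
case: (i : nat) => [_ jn | p pn jn].
  (* As [n] is at least 2, index 0 is not the last one. *)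
  rewrite wt_lt // subr0 expr0 divr1 mulr1; congr (_ * _).
  by case: (j : nat) => [|[|q]]; rewrite /= ?subr0 ?sub0r ?subn1 ?expr0 ?divr1.
rewrite (wt_lt p) // !eqSS !subSS !subn0.
have [<- | pj] := eqVneq p.+1 j.
  rewrite /= (gtn_eqF (ltnSn p.+1)) (ltn_eqF (ltnSn p)) subr0 sub0r mulrN opprK !mulr1.
  (* Only the last diagonal entry involves the exceptional weight. *)
  case: ifP => [/eqP pSn | pSn].
    by rewrite wt_max // -pSn subn1 subn2 -mulrDr [in RHS](addrC (_ / _)).
  by rewrite wt_lt; [rewrite -[in RHS]mulrDr [in RHS](addrC (_ / _)) | lia].
rewrite (eq_sym (j : nat)).
(* Off the diagonal at most one term survives: [G p.+1] just above it, [G p] just below it. *)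
have [pSj | pSj] := eqVneq p.+2 j.
  have -> : (p == j :> nat) = false by lia.
  by rewrite wt_lt ?pSj // subr0 mulr0 subr0 sub0r !mulrN mulr1.
rewrite subr0 mulr0 sub0r; case: eqP => [<- | _]; first by rewrite subr0 mulr1 mulrN.
by rewrite subr0 !mulr0 oppr0.
Qed.

Lemma invmx_ss_kernel n : (2 <= n)%N ->
  invmx (ss_kernel n alpha) = (1 / (alpha - alpha ^+ 2)) *: tmat n alpha.
Proof.
move=> n_ge2; apply: (can_inj (mulKmx (ss_kernel_unitmx n))).
rewrite mulmxV ?ss_kernel_unitmx // tmat_factor // ss_kernel_factor wmatE.
have UV : umat R n *m diffmx R n = 1%:M by apply: mulmx1C; exact: mul_diffmx_umat.
have UTVT : (umat R n)^T *m (diffmx R n)^T = 1%:M.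
  by rewrite -trmx_mul mul_diffmx_umat trmx1.
(* The six factors cancel from the inside out. *)
rewrite -!mulmxA (mulmxA _^T) UTVT mul1mx (mulmxA (diag_mx _)) mulmx_diag.
suff -> : diag_mx (\row_i ((\row_(i < n) wt n i) 0 i *
    (\row_(i < n) (wt n i)^-1) 0 i)) = 1%:M by rewrite mul1mx UV.
rewrite -diag_const_mx; congr diag_mx; apply/rowP => i.
by rewrite !mxE mulfV // gt_eqF.
Qed.

End StableSpline.

Lemma tridiagonal_tmat (R : realType) (n : nat) (alpha : R) :
  tridiagonal (tmat n alpha).
Proof.
move=> i j far; rewrite mxE /tentry !eqSS.
by do 3 (case: eqP => [?|_]; first lia).
Qed.

Theorem proposition4p3 (R : realType) (n : nat) (alpha : R)
    (hn : (2 <= n)%N) (halpha0 : 0 < alpha) (halpha1 : alpha < 1) :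
  let K : 'M[R]_n := ss_kernel n alpha in
  (solves_maxent_band alpha K
     <-> K = umat R n *m wmat n alpha *m (umat R n)^T)
  /\
  (K = umat R n *m wmat n alpha *m (umat R n)^T
     <-> [/\ K \in unitmx, tridiagonal (invmx K) &
             invmx K = (1 / (alpha - alpha ^+ 2)) *: tmat n alpha]).
Proof.
move=> K.
have factor := ss_kernel_factor halpha1 n.
split; split=> _ //; first exact: ss_kernel_maxent.
have invK := invmx_ss_kernel halpha0 halpha1 hn.
split=> //; first exact: ss_kernel_unitmx.
by rewrite invK => i j far; rewrite mxE tridiagonal_tmat ?mulr0.
Qed.
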